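(* Let $X$ be an analytic metric space and let $s$ be a real number such that $\dim_{\mathsf P} X>s$. Then there is a set $S\subseteq X$ such that $\dim_{\mathsf P} S>s$ and $S$ (with the restricted metric) is Lipschitz-equivalent to an ultrametric space.
   Context: All spaces are separable metric spaces. A metric space is analytic if it is a continuous image of a complete separable metric space. $B(x,r)$ denotes the closed ball with center $x$ and radius $r>0$. Packing measure. Let $E$ be a subset of a metric space $X$. A family of balls $\{B(x_i,r_i):i\in I\}$ is a packing of $E$ if $x_i\in E$ for all $i$ and $x_j\notin B(x_i,r_i)$ whenever $i\neq j$. It is $\delta$-fine if $r_i\le\delta$ for all $i$. For $s>0$ let $\mathcal P^s_\delta(E)=\sup\{\sum_{i\in I}r_i^s:\{B(x_i,r_i):i\in I\}\text{ is a }\delta\text{-fine packing of }E\}$, $\mathcal P^s_0(E)=\inf_{\delta>0}\mathcal P^s_\delta(E)$, and $\mathcal P^s(E)=\inf\sum_n\mathcal P^s_0(E_n)$, the infimum being over all countable covers $\{E_n\}$ of $E$. Packing dimension: $\dim_{\mathsf P}E=\inf\{s>0:\mathcal P^s(E)=0\}\in[0,\infty]$. A metric space $(U,d)$ is ultrametric if $d(x,z)\le\max\{d(x,y),d(y,z)\}$ for all $x,y,z\in U$. Two metric spaces are Lipschitz-equivalent if there is a Lipschitz bijection between them with a Lipschitz inverse. *)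

(* Defs.v *)
From HB Require Import structures.
From mathcomp Require Import all_boot all_order all_algebra.
From mathcomp Require Import all_classical all_reals all_analysis.

Set Implicit Arguments.
Unset Strict Implicit.
Unset Printing Implicit Defensive.

Import Order.TTheory GRing.Theory Num.Theory.

Local Open Scope classical_set_scope.
Local Open Scope ring_scope.

(* A subset of a metric space is a metric space for the restricted distance;
   the ball, uniform and topological structures are the library's ones. *)
Section set_type_metric.
Context {R : realType} {X : metricType R} (A : set X).

Let dist (x y : A) : R := mdist (set_val x) (set_val y).

Let dist_ge0 x y : 0 <= dist x y.
Proof. exact: mdist_ge0. Qed.

Let dist_positivity x y : dist x y = 0 -> x = y.
Proof. by move/mdist_positivity => xy; exact: val_inj. Qed.

Let ballE x d : ball x d = [set y | dist x y < d].
Proof.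
have -> : ball x d = set_val @^-1` ball (set_val x) d by [].
by rewrite ballEmdist.
Qed.

HB.instance Definition _ :=
  @PseudoMetric_isMetric.Build R A dist dist_ge0 dist_positivity ballE.

End set_type_metric.

Definition separable (T : topologicalType) : Prop :=
  exists D : set T, countable D /\ dense D.

(* The library's completeType is pointed; this is the same condition without a
   base point, so that the empty space is complete, hence analytic. *)
Definition complete_space (T : uniformType) : Prop :=
  forall F : set_system T, ProperFilter F -> cauchy F -> exists x : T, F --> x.

Definition analytic {R : realType} (X : metricType R) : Prop :=
  exists (P : metricType R) (f : P -> X),
    [/\ complete_space P, separable P, continuous f & range f = [set: X]].

Section packing.
Context {R : realType} {X : metricType R}.
Implicit Types (E : set X) (s delta : R).

(* The library's closed_ball is the closure of an open ball, which may be a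
   proper subset of the closed ball of a general metric space. *)
Definition cball (x : X) (r : R) : set X := [set y | mdist x y <= r].

Definition is_packing E (I : Type) (x : I -> X) (r : I -> R) : Prop :=
  [/\ forall i, E (x i),
      forall i, 0 < r i &
      forall i j, i <> j -> ~ cball (x i) (r i) (x j)].

Definition is_fine delta (I : Type) (r : I -> R) : Prop :=
  forall i, r i <= delta.

Definition packing_delta s delta E : \bar R :=
  ereal_sup [set v | exists (I : choiceType) (x : I -> X) (r : I -> R),
    [/\ is_packing E x r, is_fine delta r &
        v = \esum_(i in [set: I]) (r i `^ s)%:E]].

Definition packing_pre s E : \bar R :=
  ereal_inf [set packing_delta s delta E | delta in [set delta | 0 < delta]].

Definition packing_measure s E : \bar R :=
  ereal_inf [set (\sum_(0 <= n <oo) packing_pre s (F n))%E |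
             F in [set F : nat -> set X | E `<=` \bigcup_n F n]].

Definition packing_dim E : \bar R :=
  ereal_inf [set s%:E | s in [set s | 0 < s /\ packing_measure s E = 0%E]].

End packing.

Definition ultrametric {R : realType} (U : metricType R) : Prop :=
  forall x y z : U, mdist x z <= Num.max (mdist x y) (mdist y z).

Definition lipschitz_map {R : realType} {X Y : metricType R} (f : X -> Y) :
    Prop :=
  exists L : R, forall x y, mdist (f x) (f y) <= L * mdist x y.

Definition lipschitz_equivalent {R : realType} (X Y : metricType R) : Prop :=
  exists (f : X -> Y) (g : Y -> X),
    [/\ cancel f g, cancel g f, lipschitz_map f & lipschitz_map g].

(* Main.v *)
Require Import Defs.
From HB Require Import structures.
From mathcomp Require Import finmap.
From mathcomp Require Import all_boot all_order all_algebra.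
From mathcomp Require Import all_classical all_reals all_analysis.
From mathcomp Require Import lra.

Import Order.TTheory GRing.Theory Num.Theory.

Local Open Scope classical_set_scope.
Local Open Scope ring_scope.

Set Implicit Arguments.
Unset Strict Implicit.

(** A set embeds in an ultrametric space with bounded distortion as soon as it
is flat: whenever two of its points are joined by a chain of points of the set
with steps at most e, their distance is at most a constant times e.  The infimum
of the e that work for a given pair of points is then an ultrametric, comparable to
the original distance (flat_ultrametric).  It remains to find a flat set of
packing dimension greater than s.

The finite form of this is a Ramsey theorem (ramsey): a finite metric space
with weights w of total mass at least 1 has a subset that is flat with constant
16k and on which the weights w^(1-1/k) still have total mass at least 1.  Taking
for w the t-th powers of the radii of a packing, with t > s, and k so large that
t(1-1/k) > s, every finite packing contains a flat packing at the price of a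
small loss in the exponent.

To pass to an infinite set, let f be a continuous map of a complete separable
space P onto X.  Since X has packing dimension greater than t, it is not
covered by countably many thin sets, a set being thin when the t-th powers of
the radii of its fine packings have sums at most 1 (sigma_thin_packing_dim).
The points of P none of whose neighbourhoods has an image covered by countably
many thin sets form the residue of f; by the Lindelof property the image of its
complement has such a cover (sigma_thin_residueC), so that near every point of
the residue there are points of the residue whose images carry arbitrarily fine
packings of mass at least 1 (residue_packing).  The Ramsey theorem makes them flat (refine_ex).
This is iterated on a tree of balls of P: the children of a node are centred at
the points given by refine_ex, and their radii are so small that, seen through
f, each child is negligible compared with its distance to its siblings.

The attractor of the tree consists of the values of f at the limits of the
branches.  It is flat because a chain with small steps cannot leave a node, and
inside a node it shadows a chain of centres (attractor_flat).  Its packing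
measure for the exponent t(1-1/k) is at least 1 by a Baire category argument: if
the attractor is covered by countably many sets, one of them meets all children
of arbitrarily deep nodes, since otherwise a branch could be chosen that avoids
all of them; picking a point in every child transfers the packing of the centres
to that set (attractor_packing_pre). *)

(** * Chains and flat sets *)

Section linked.
Context {R : realType} {T : Type}.
Variable d : T -> T -> R.

(** Reachability of y from x by steps of length at most e inside S, stated as
membership in every set that contains x and is closed under such steps. *)
Definition linked (S : set T) (e : R) (x y : T) : Prop :=
  forall A : set T, A x ->
    (forall a b, A a -> S b -> d a b <= e -> A b) -> A y.

(** Bi-Lipschitz embeddability into an ultrametric space, without reference to
an ultrametric. *)
Definition flat (D : R) (S : set T) : Prop :=
  forall (e : R) x y, 0 <= e -> S x -> S y -> linked S e x y -> d x y <= D * e.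

Lemma linked_refl S e x : linked S e x x.
Proof. by []. Qed.

Lemma linked_step S e x y : S y -> d x y <= e -> linked S e x y.
Proof. by move=> Sy xy A Ax cA; exact: cA xy. Qed.

Lemma linked_trans S e y x z : linked S e x y -> linked S e y z ->
  linked S e x z.
Proof. by move=> xy yz A Ax cA; exact: yz (xy _ Ax cA) cA. Qed.

Lemma linked_le S e e' x y : e <= e' -> linked S e x y -> linked S e' x y.
Proof.
move=> ee' xy A Ax cA; apply: xy => // a b Aa Sb ab.
by apply: (cA a) => //; apply: le_trans ee'.
Qed.

(** The way flatness is proved for sets made of separated pieces: a chain that
starts in a piece A, and whose steps are too short to leave A, is a chain of
A. *)
Lemma linked_inside (S A : set T) e x y : A x ->
  (forall a b, A a -> S b -> d a b <= e -> A b) -> linked S e x y ->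
  A y /\ linked A e x y.
Proof.
move=> Ax cA xy; apply: (xy (fun z => A z /\ linked A e x z)).
  by split => //; exact: linked_refl.
move=> a b [Aa xa] Sb ab; have Ab := cA _ _ Aa Sb ab; split => //.
exact: linked_trans xa (linked_step Ab ab).
Qed.

End linked.

(** * The Ramsey theorem for weighted finite metric spaces *)

Lemma small_enough {R : realType} (I : finType) (Q : I -> R -> Prop) :
  (forall i e e', 0 < e' -> e' <= e -> Q i e -> Q i e') ->
  (forall i, exists2 e, 0 < e & Q i e) ->
  exists2 e, 0 < e & forall i, Q i e.
Proof.
move=> Qle Qex.
have /choice[e eP] : forall i, exists e, 0 < e /\ Q i e.
  by move=> i; have [e e0 Qe] := Qex i; exists e.
have m0 : 0 < \big[Order.min/1]_i e i.
  by elim/big_ind: _ => // [x y x0 y0|i _]; [rewrite lt_min x0|case: (eP i)].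
exists (\big[Order.min/1]_i e i) => // i.
apply: (Qle i (e i)) => //; last by case: (eP i).
exact: bigmin_le.
Qed.

Section ramsey.
Context {R : realType} {T : finType}.
Variables (d : T -> T -> R) (w : T -> R) (k : nat).
Hypotheses (dxx : forall x, d x x = 0) (dsym : forall x y, d x y = d y x)
  (dtri : forall y x z, d x z <= d x y + d y z)
  (dpos : forall x y, x != y -> 0 < d x y)
  (w_gt0 : forall x, 0 < w x) (k_gt0 : (0 < k)%N).

Let mass (A : {set T}) : R := \sum_(z in A) w z.
Let within (Y : {set T}) (x : T) (r : R) : {set T} := [set y in Y | d x y <= r]%SET.
Let alpha : R := k%:R^-1.

Let k0 : 0 < k%:R :> R. Proof. by rewrite ltr0n. Qed.
Let alpha_gt0 : 0 < alpha. Proof. by rewrite invr_gt0. Qed.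
Let alpha_le1 : alpha <= 1. Proof. by rewrite invf_le1// ler1n. Qed.

Let mass_ge0 A : 0 <= mass A.
Proof. by apply: sumr_ge0 => z _; apply: ltW. Qed.

Let mass_sub (A B : {set T}) : A \subset B -> mass A <= mass B.
Proof.
move=> /finset.setIidPr AB; rewrite /mass [leRHS](big_setID A)/= AB lerDl.
exact: mass_ge0.
Qed.

Let mass_mem (A : {set T}) z : z \in A -> w z <= mass A.
Proof. by move=> zA; rewrite -[w z](big_set1 +%R z w) mass_sub// finset.sub1set. Qed.

Let within_mem (Y : {set T}) x (r : R) : 0 <= r -> x \in Y -> x \in within Y x r.
Proof. by move=> r0 xY; rewrite inE xY dxx. Qed.

Let within_sub (Y : {set T}) x r : within Y x r \subset Y.
Proof. by apply/fintype.subsetP => y; rewrite inE => /andP[]. Qed.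

Let within_le (Y : {set T}) x r r' : r <= r' -> within Y x r \subset within Y x r'.
Proof.
by move=> rr'; apply/fintype.subsetP => y; rewrite !inE => /andP[-> /le_trans->].
Qed.

(** Were the mass to grow by more than the k-th root of b / a across each of the
k annuli, it would grow by more than b / a in all, where a and b are the masses
of the innermost and of the outermost ball. *)
Lemma slow_annulus (Y : {set T}) (x : T) (r g : R) : 0 <= r -> x \in Y ->
  exists2 j : nat, (j < k)%N &
    mass (within Y x (r + j.+1%:R * g)) <=
    (mass (within Y x (r + k%:R * g)) / mass (within Y x r)) `^ alpha *
    mass (within Y x (r + j%:R * g)).
Proof.
move=> r0 xY; set b := mass (within Y x (r + _)); set a := mass (within Y x r).
set l := _ `^ _.
have a0 : 0 < a by rewrite (lt_le_trans (w_gt0 x))// mass_mem// within_mem.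
have lk : l ^+ k = b / a.
  rewrite -powR_mulrn ?powR_ge0// /l -powRrM /alpha mulVf ?gt_eqF// powRr1//.
  by rewrite divr_ge0// mass_ge0.
have l0 : 0 <= l by exact: powR_ge0.
apply: contrapT => H.
have {}H j : (j < k)%N -> l * mass (within Y x (r + j%:R * g)) <
     mass (within Y x (r + j.+1%:R * g)).
  by move=> jk; rewrite ltNge; apply/negP => ?; apply: H; exists j.
have K j : (0 < j)%N -> (j <= k)%N -> l ^+ j * a < mass (within Y x (r + j%:R * g)).
  elim: j => // -[_ _ k1|j IH _ jk].
    by have := H _ k1; rewrite mul0r addr0 expr1.
  apply: le_lt_trans (H _ jk); rewrite exprS -mulrA ler_wpM2l// ltW// IH//.
  exact: ltnW.
have := K k k_gt0 (leqnn k); rewrite lk -mulrA mulVf ?mulr1 ?gt_eqF//.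
by rewrite -/b ltxx.
Qed.

(** Induction on the scale r = c * 4 ^ m; at each scale, clusters of diameter at
most 4r are carved out of Y one after the other.  The next cluster is a ball
around the point x whose r-ball in Y is heaviest, with a radius between r and 2r
chosen by slow_annulus; the annulus of width r / k around it is thrown away,
which separates the cluster from the rest.  Keeping the cluster instead of the
ball with its annulus loses a factor (b / a) ^ (1/k), where a and b are the
masses of the balls of radii r and 2r around x.  For every z of the cluster,
a is at least the mass of the r-ball around z, by the choice of x, and b is at
most the mass of the 4r-ball around z.  Hence the loss is absorbed by the
passage from scale r to scale 4r of the local mass at z in the second
conclusion, and the losses telescope over the scales. *)
Lemma ramsey_scales (c : R) (m : nat) (Y : {set T}) : 0 < c ->
  (forall x y, x != y -> c <= d x y) ->
  exists S : {set T}, [/\ S \subset Y,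
    mass Y <= \sum_(z in S) w z `^ (1 - alpha) *
                mass (within Y z (c * 4 ^+ m)) `^ alpha &
    forall (e : R) x y, 0 <= e -> e < c * 4 ^+ m / (4 * k%:R) ->
      x \in S -> y \in S -> linked d [set` S] e x y ->
      d x y <= 16 * k%:R * e].
Proof.
move=> c0 cd; elim: m Y => [|m IHm] Y.
  exists Y; split => //.
    apply: ler_sum => z zY; rewrite -{1}(powRr1 (ltW (w_gt0 z))).
    rewrite -{1}(subrK alpha 1) powRD; last by rewrite (gt_eqF (w_gt0 z)) implybT.
    rewrite ler_wpM2l ?powR_ge0// ge0_ler_powR ?nnegrE ?(ltW alpha_gt0)//.
      exact: ltW.
    by rewrite mass_mem// within_mem// expr0 mulr1 ltW.
  move=> e x y e0 ec xY yY xy.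
  suff -> : y = x by rewrite dxx !mulr_ge0.
  apply: (xy [set x]) => //= a b -> _ ab; apply: contrapT => /eqP bx.
  have := cd _ _ bx; rewrite dsym leNgt => /negP; apply.
  apply: (le_lt_trans ab); apply: (lt_le_trans ec).
  rewrite expr0 mulr1 ler_pdivrMr ?mulr_gt0// ler_peMr ?(ltW c0)//.
  by rewrite -natrM ler1n muln_gt0.
(* At a fixed scale, clusters are carved until Y is exhausted. *)
have [n] := ubnP #|Y|; elim: n Y => // n IHn Y /ltnSE Yn.
have [->|/set0Pn[x0 x0Y]] := eqVneq Y finset.set0.
  exists finset.set0; split; rewrite ?finset.sub0set// ?/mass ?big_set0//.
  by move=> e x y _ _; rewrite inE.
set r := c * 4 ^+ m.
have r0 : 0 < r by rewrite mulr_gt0 ?exprn_gt0.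
have r4 : c * 4 ^+ m.+1 = 4 * r by rewrite exprS mulrCA.
set g := r / k%:R.
have g0 : 0 < g by rewrite divr_gt0.
have kg : k%:R * g = r by rewrite mulrC divfK ?gt_eqF.
have [x xY xmax] : exists2 x, x \in Y &
    forall z, z \in Y -> mass (within Y z r) <= mass (within Y x r).
  pose x := [arg max_(i > x0 in Y) mass (within Y i r)]%O.
  exists x; rewrite /x; case: arg_maxP => //.
have [j jk Hj] := slow_annulus g (ltW r0) xY.
set C := within Y x (r + j%:R * g) in Hj.
set C' := within Y x (r + _) in Hj.
set b := mass (within Y x (r + k%:R * g)) in Hj; set a := mass (within Y x r) in Hj.
have CC' : C \subset C'.
  by apply: within_le; rewrite lerD2l ler_wpM2r ?(ltW g0)// ler_nat.
have jg : 0 <= j%:R * g by rewrite mulr_ge0// ltW.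
have j1g : j.+1%:R * g <= r by rewrite -kg ler_wpM2r ?(ltW g0)// ler_nat.
have jg1 : j%:R * g + g <= r by move: j1g; rewrite -natr1 mulrDl mul1r.
have xC' : x \in C'.
  apply: within_mem => //; apply: addr_ge0; first exact: ltW.
  by apply: mulr_ge0 => //; exact: ltW.
have [SC [SCs SCm SCf]] := IHm C.
have [|SD [SDs SDm SDf]] := IHn (Y :\: C')%SET.
  apply: leq_trans Yn; apply: proper_card; apply/fintype.properP; split.
    exact: finset.subsetDl.
  by exists x => //; rewrite inE xC'.
have gap u v : u \in C -> v \in (Y :\: C')%SET -> g < d u v.
  rewrite !inE -natr1 => /andP[uY xu] /andP[+ vY]; rewrite vY/= -ltNge => xv.
  have := dtri u x v; move: xu xv; rewrite mulrDl mul1r; lra.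
exists (SC :|: SD)%SET; split.
- rewrite finset.subUset (fintype.subset_trans SCs (within_sub _ _ _))/=.
  exact: fintype.subset_trans SDs (finset.subsetDl _ _).
- have disj : fintype.disjoint (mem SC) (mem SD).
    apply/pred0P => z /=; apply/negbTE/negP => /andP[zC zD].
    have := gap z z (fintype.subsetP SCs _ zC) (fintype.subsetP SDs _ zD).
    by rewrite dxx ltNge (ltW g0).
  rewrite {1}/mass (big_setID C')/=.
  rewrite [leRHS](eq_bigl [in [predU SC & SD]]); last by move=> z; rewrite !inE.
  rewrite [leRHS]bigU//=.
  have -> : (Y :&: C')%SET = C' by apply/finset.setIidPr; exact: within_sub.
  rewrite -!/(mass _) lerD//; last first.
    apply: (le_trans SDm); apply: ler_sum => z zD.
    rewrite ler_wpM2l ?powR_ge0// ge0_ler_powR ?nnegrE ?(ltW alpha_gt0)//.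
    apply: mass_sub; apply/fintype.subsetP => y; rewrite !inE => /andP[/andP[_ ->]].
    by [].
  apply: (le_trans Hj); rewrite (le_trans (ler_wpM2l _ SCm)) ?powR_ge0//.
  rewrite mulr_sumr; apply: ler_sum => z zS.
  have a0 : 0 < a by rewrite (lt_le_trans (w_gt0 x))// mass_mem// within_mem// ltW.
  have b0 : 0 <= b by exact: mass_ge0.
  rewrite mulrCA ler_wpM2l ?powR_ge0// -powRM ?divr_ge0 ?(ltW a0)//.
  have /andP[zY xz] : (z \in Y) && (d x z <= r + j%:R * g).
    by have := fintype.subsetP SCs _ zS; rewrite inE.
  rewrite ge0_ler_powR ?nnegrE ?mulr_ge0 ?invr_ge0 ?(ltW alpha_gt0) ?(ltW a0)//.
  apply: (@le_trans _ _ b); last first.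
    apply: mass_sub; apply/fintype.subsetP => y; rewrite !inE kg r4 => /andP[-> xy]/=.
    have := dtri x z y; rewrite (dsym z x); move: xz; lra.
  rewrite -mulrA ler_piMr// mulrC ler_pdivrMr// mul1r.
  apply: le_trans (xmax z zY); apply: mass_sub.
  by apply/fintype.subsetP => y; rewrite !inE => /andP[/andP[-> _]].
- move=> e u v e0; rewrite r4 -mulf_div divff ?mul1r// -/g => eg.
  have stays (S1 S2 : {set T}) : (SC :|: SD)%SET = (S1 :|: S2)%SET ->
      (forall u v, u \in S1 -> v \in S2 -> e < d u v) -> u \in S1 ->
      linked d [set` (SC :|: SD)%SET] e u v -> v \in S1 /\ linked d [set` S1] e u v.
    move=> -> S12 uS1; apply: linked_inside => // p q pS1.
    rewrite /= inE => /orP[//|qS2]; rewrite leNgt => /negP[].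
    exact: S12.
  have gapS p q : p \in SC -> q \in SD -> e < d p q.
    move=> pS qS; apply: lt_trans eg _.
    by apply: gap; [exact: (fintype.subsetP SCs)|exact: (fintype.subsetP SDs)].
  rewrite inE => /orP[uS _|uS _] uv.
    have [vS {}uv] := stays SC SD erefl gapS uS uv.
    have [em|me] := ltP e (c * 4 ^+ m / (4 * k%:R)); first exact: SCf.
    have /andP[_ xu] : (u \in Y) && (d x u <= r + j%:R * g).
      by have := fintype.subsetP SCs _ uS; rewrite inE.
    have /andP[_ xv] : (v \in Y) && (d x v <= r + j%:R * g).
      by have := fintype.subsetP SCs _ vS; rewrite inE.
    have : 4 * r <= 16 * k%:R * e.
      move: me; rewrite ler_pdivrMr ?mulr_gt0// -/r; lra.
    have := dtri x u v; rewrite (dsym u x); lra.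
  have [vS {}uv] : v \in SD /\ linked d [set` SD] e u v.
    apply: (stays SD SC) => //; first by rewrite finset.setUC.
    by move=> p q pS qS; rewrite dsym gapS.
  apply: SDf => //; rewrite r4 -mulf_div divff ?mul1r//.
Qed.


(** At a scale exceeding the diameter, the local masses in ramsey_scales are at
most the total mass W, so the sum is at least W ^ (1 - 1/k). *)
Lemma ramsey : 1 <= \sum_z w z -> exists S : {set T},
  1 <= \sum_(z in S) w z `^ (1 - alpha) /\ flat d (16 * k%:R) [set` S].
Proof.
move=> W1.
have [c c0 cd] : exists2 c, 0 < c & forall x y, x != y -> c <= d x y.
  have [c c0 cd] : exists2 c, 0 < c & forall p : T * T, p.1 != p.2 -> c <= d p.1 p.2.
    apply: small_enough => [p e e' _ ee' H pp|p].
      by apply: le_trans ee' _; exact: H.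
    have [pp|pp] := eqVneq p.1 p.2; first by exists 1.
    by exists (d p.1 p.2); [exact: dpos|].
  by exists c => // x y xy; exact: (cd (x, y)).
have d0 x y : 0 <= d x y.
  by have [->|/dpos/ltW//] := eqVneq x y; rewrite dxx.
pose M := \sum_x \sum_y d x y.
have dM x y : d x y <= M.
  rewrite /M (bigD1 x)//= (bigD1 y)//= -addrA lerDl.
  by rewrite addr_ge0 ?sumr_ge0// => *; apply: sumr_ge0.
have [m Mm] : exists m, M <= c * 4 ^+ m.
  have M0 : 0 <= M / c.
    by rewrite divr_ge0 ?(ltW c0)// sumr_ge0// => x _; apply: sumr_ge0.
  exists (Num.bound (M / c)); rewrite mulrC -ler_pdivrMr//.
  apply: (le_trans (ltW (archi_boundP M0))).
  by rewrite -natrX ler_nat ltnW// ltn_expl.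
have [S [_ Sm Sf]] := ramsey_scales m finset.setT c0 cd.
exists S; split.
  have T1 : 1 <= mass finset.setT.
    by apply: (le_trans W1); rewrite /mass [leRHS](eq_bigl xpredT)// => z; rewrite inE.
  rewrite -(ler_pM2r (lt_le_trans ltr01 T1)) mul1r; apply: (le_trans Sm).
  rewrite mulr_suml; apply: ler_sum => z _; rewrite ler_wpM2l ?powR_ge0//.
  apply: le_trans (ler1_powR T1 alpha_le1).
  rewrite ge0_ler_powR ?nnegrE ?(ltW alpha_gt0)//.
  exact/mass_sub/within_sub.
move=> e x y e0 xS yS xy.
have [em|me] := ltP e (c * 4 ^+ m / (4 * k%:R)); first exact: Sf.
apply: (le_trans (dM x y)); apply: (le_trans Mm); move: me.
rewrite ler_pdivrMr ?mulr_gt0// => /le_trans; apply.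
by have : 0 <= k%:R * e; [rewrite mulr_ge0 // ltW | lra].
Qed.

End ramsey.

(** * Packing measures and thin sets *)

Section thin.
Context {R : realType} {X : metricType R}.
Implicit Types (E F : set X) (t u : R).

Lemma packing_delta_ge0 t delta E : (0 <= packing_delta t delta E)%E.
Proof.
apply: ereal_sup_ubound; exists void, (fun i : void => match i with end),
  (fun i : void => match i with end); split => //.
by rewrite esum1// => -[].
Qed.

Lemma packing_pre_ge0 t E : (0 <= packing_pre t E)%E.
Proof. by apply: le_ereal_inf_tmp => _ [delta _ <-]; exact: packing_delta_ge0. Qed.

Lemma packing_measure_ge0 t E : (0 <= packing_measure t E)%E.
Proof.
apply: le_ereal_inf_tmp => _ [F _ <-].
by apply: nneseries_ge0 => n _ _; exact: packing_pre_ge0.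
Qed.

Lemma packing_dim_ge0 E : (0 <= packing_dim E)%E.
Proof.
by apply: le_ereal_inf_tmp => _ [s [s0 _] <-]; rewrite lee_fin ltW.
Qed.

Lemma packing_delta_ge t delta E (I : finType) (x : I -> X) (r : I -> R) :
  is_packing E x r -> is_fine delta r ->
  ((\sum_i r i `^ t)%:E <= packing_delta t delta E)%E.
Proof.
move=> xr dr; have fI : finite_set [set: I] by exact: finite_finset.
apply: ereal_sup_ubound; exists I, x, r; split => //.
rewrite esum_fset//=; last by move=> i _; rewrite lee_fin powR_ge0.
rewrite fsbig_finite//= -sumEFin; apply: perm_big; apply: uniq_perm.
- exact: index_enum_uniq.
- exact: finmap.fset_uniq.
by move=> i; rewrite mem_index_enum in_fset_set//; exact/esym/mem_set.
Qed.

(** Only finite packings are considered: their sums determine the sums over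
arbitrary packings, and the Ramsey theorem is about finite spaces. *)
Definition thin t F : Prop := exists2 delta, 0 < delta &
  forall (I : finType) (x : I -> X) (r : I -> R),
    is_packing F x r -> is_fine delta r -> \sum_i r i `^ t <= 1.

Definition sigma_thin t E : Prop := exists2 F : nat -> set X,
  E `<=` \bigcup_n F n & forall n, thin t (F n).

Lemma thin_set0 t : thin t set0.
Proof.
exists 1 => // I x r [xr _ _] _.
by rewrite big1// => i; have := xr i.
Qed.

Lemma sigma_thinS t E F : E `<=` F -> sigma_thin t F -> sigma_thin t E.
Proof. by move=> EF [G FG Gt]; exists G => //; exact: subset_trans FG. Qed.

Lemma sigma_thin_set0 t : sigma_thin t set0.
Proof. by exists (fun _ => set0) => // n; exact: thin_set0. Qed.

Lemma sigma_thin_bigcup t (E : nat -> set X) :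
  (forall n, sigma_thin t (E n)) -> sigma_thin t (\bigcup_n E n).
Proof.
move=> Et; have /choice[F FP] : forall n, exists F : nat -> set X,
    E n `<=` \bigcup_m F m /\ forall m, thin t (F m).
  by move=> n; have [F ? ?] := Et n; exists F.
pose dec (k : nat) : nat * nat := odflt (0%N, 0%N) (unpickle k).
exists (fun k => F (dec k).1 (dec k).2); last by move=> k; have [_] := FP (dec k).1.
move=> x [n _ nx]; have [/(_ x nx)[m _ mx] _] := FP n.
by exists (pickle (n, m)) => //; rewrite /dec pickleK.
Qed.

(** Since r ^ u = r ^ (u - t) * r ^ t, raising the exponent multiplies the sums
over eta-fine packings by at most eta ^ (u - t), which tends to 0 with eta. *)
Lemma thin_packing_pre t u F : t < u -> thin t F -> packing_pre u F = 0%E.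
Proof.
move=> tu [delta delta0 Ft]; apply/eqP; rewrite eq_le packing_pre_ge0 andbT.
apply/lee_addgt0Pr => e e0; rewrite add0e.
have ut : 0 < u - t by rewrite subr_gt0.
pose eta := Num.min delta (e `^ (u - t)^-1).
have eta0 : 0 < eta by rewrite lt_min delta0 powR_gt0.
apply: (@le_trans _ _ (packing_delta u eta F)).
  by apply: ereal_inf_lbound; exists eta.
apply: ge_ereal_sup => _ [I [x [r [[xF r0 xr] rfine ->]]]].
apply: ge_ereal_sup => _ [A [finA _] <-].
rewrite fsbig_finite//= finmap.big_seq_fsetE/= sumEFin lee_fin.
pose A' := finmap.fset_sub_type (fset_set A).
pose h (i : A') : I := \val i.
have h_inj : injective h by exact: val_inj.
apply: (@le_trans _ _ (\sum_(i : A') e * r (h i) `^ t)).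
  apply: ler_sum => i _.
  rewrite -{1}(subrK t u) powRD; last by rewrite (gt_eqF (r0 _)) implybT.
  rewrite ler_wpM2r ?powR_ge0//.
  have : r (h i) <= e `^ (u - t)^-1.
    by have := rfine (h i); rewrite /eta le_min => /andP[].
  move=> /(@ge0_ler_powR _ (u - t) (ltW ut)); rewrite !nnegrE => /(_ (ltW (r0 _))).
  by move=> /(_ (powR_ge0 _ _)); rewrite -powRrM mulVf ?gt_eqF// powRr1// ltW.
rewrite -mulr_sumr ler_piMr ?(ltW e0)//.
apply: (Ft _ (fun i : A' => x (h i)) (fun i => r (h i))).
  split => // i j ij; by apply: xr => /h_inj.
by move=> i; have := rfine (h i); rewrite /eta le_min => /andP[].
Qed.

Lemma sigma_thin_packing_measure t u E : t < u -> sigma_thin t E ->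
  packing_measure u E = 0%E.
Proof.
move=> tu [F EF Ft]; apply/eqP; rewrite eq_le packing_measure_ge0 andbT.
apply: ereal_inf_lbound; exists F => //.
by apply: eseries0 => n _ _; exact: thin_packing_pre tu (Ft n).
Qed.

Lemma sigma_thin_packing_dim t u E : 0 < u -> t < u -> sigma_thin t E ->
  (packing_dim E <= u%:E)%E.
Proof.
move=> u0 tu Et; apply: ereal_inf_lbound; exists u => //; split => //.
exact: sigma_thin_packing_measure Et.
Qed.

End thin.

(** * The residue of a map from a separable space *)

Section residue.
Context {R : realType} {P X : metricType R}.

Lemma dense_ball (T : metricType R) (D : set T) x e : dense D -> 0 < e ->
  exists2 y, D y & mdist x y < e.
Proof.
move=> denseD e0.
have [] := denseD (ball x e)^°%classic _ (open_interior _).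
  by exists x; exact: nbhsx_ballx.
move=> y [/interior_subset]; rewrite ballEmdist/= => xy Dy.
by exists y.
Qed.

Lemma separable_enum (T : metricType R) : separable T -> T ->
  exists e : nat -> T, forall x r, 0 < r -> exists n, mdist x (e n) < r.
Proof.
move=> [D [cD denseD]] x0.
have [d0 Dd0 _] := dense_ball x0 denseD ltr01.
have [f fP] : exists f : nat -> T, D `<=` range f.
  move/pfcard_geP : cD => [D0|[f]]; first by rewrite D0 in Dd0.
  exists f => y /(@surj _ _ _ _ f)[n _ <-].
  by exists n.
exists f => x r r0; have [y Dy xy] := dense_ball x denseD r0.
by have [n _ ny] := fP _ Dy; exists n; rewrite ny.
Qed.

Definition residue (f : P -> X) t : set P :=
  [set p | forall r, 0 < r -> ~ sigma_thin t (f @` [set q | mdist p q < r])].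

(** Lindelof: the balls with centre in a dense sequence and radius 1 / (m + 1)
that have a sigma-thin image cover the complement of the residue. *)
Lemma sigma_thin_residueC (f : P -> X) t : separable P ->
  sigma_thin t (f @` (~` residue f t)).
Proof.
move=> sepP; have [[p0 _]|nP] := pselect (exists p : P, True); last first.
  apply: sigma_thinS (sigma_thin_set0 t) => x [p _ _].
  by apply: nP; exists p.
have [e eP] := separable_enum sepP p0.
pose dec (k : nat) : nat * nat := odflt (0%N, 0%N) (unpickle k).
pose B k := [set q | mdist (e (dec k).1) q < (dec k).2.+1%:R^-1].
pose E k := if `[< sigma_thin t (f @` B k) >] then f @` B k else set0.
apply: (@sigma_thinS _ _ _ _ (\bigcup_k E k)); last first.
  apply: sigma_thin_bigcup => k; rewrite /E; case: asboolP => // _.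
  exact: sigma_thin_set0.
move=> _ [p /= pr <-].
have [r r0 pt] : exists2 r, 0 < r & sigma_thin t (f @` [set q | mdist p q < r]).
  apply: contrapT => H; apply: pr => r r0 pt; apply: H; by exists r.
have [m mr] : exists m : nat, m.+1%:R^-1 < r / 2.
  have r2 : 0 < r / 2 by rewrite divr_gt0.
  by have [m] := ltr_add_invr r2; rewrite add0r; exists m.
have m0 : 0 < m.+1%:R^-1 :> R by rewrite invr_gt0.
have [n pn] := eP p _ m0.
exists (pickle (n, m)) => //; rewrite /E /B /dec pickleK/=.
case: asboolP => [_|[]]; first by exists p => //=; rewrite metric_sym.
apply: sigma_thinS pt => _ [q /= nq <-]; exists q => //=.
apply: le_lt_trans (metric_triangle p (e n) q) _.
by apply: lt_trans (ltrD pn nq) _; rewrite [ltRHS]splitr ltrD.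
Qed.

End residue.

(** * One step of the tree construction *)

Lemma flat_comp {R : realType} {J T : Type} (d : T -> T -> R) (h : J -> T) D
    (S : set T) : (forall j, S (h j)) -> flat d D S ->
  flat (fun a b => d (h a) (h b)) D [set: J].
Proof.
move=> hS Sf e a b e0 _ _ ab; apply: Sf => // A Aa cA.
by apply: (ab (h @^-1` A)) => // u v Au _ uv; exact: cA uv.
Qed.

Section refinement.
Context {R : realType} {P X : metricType R}.
Variable f : P -> X.

(** The balls of radius [radius] around the centers are the children of a node;
[size_of] gives the radii in X of a packing by the images of the centers. *)
Record children := Children {
  child_index : finType;
  center : child_index -> P;
  size_of : child_index -> R;
  radius : R }.

(** Any choice of one point in each child has, through f, the same metric
structure as the family of centers up to a factor 2, and is the set of centers
of a packing with the same radii (child_sep); each child is smaller than its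
distance to any other (child_diam). *)
Record refines (good : set P) (D s : R) (N : P * R) (delta : R)
    (K : children) : Prop := Refines {
  radius_gt0 : 0 < radius K;
  radius_le : radius K <= delta;
  center_good : forall i, good (@center K i);
  child_sub : forall i y, mdist (@center K i) y <= radius K -> mdist N.1 y <= N.2;
  size_of_gt0 : forall i, 0 < @size_of K i;
  size_of_le : forall i, @size_of K i <= delta;
  size_of_sum : 1 <= \sum_i @size_of K i `^ s;
  center_flat :
    flat (fun i j => mdist (f (@center K i)) (f (@center K j))) D setT;
  child_sep : forall i j y z, i <> j ->
    mdist (@center K i) y <= radius K -> mdist (@center K j) z <= radius K ->
    [/\ @size_of K i < mdist (f y) (f z),
        mdist (f (@center K i)) (f (@center K j)) <= 2 * mdist (f y) (f z) &
        mdist (f y) (f z) <= 2 * mdist (f (@center K i)) (f (@center K j))];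
  child_diam : forall i j y y' y'' z, i <> j ->
    mdist (@center K i) y <= radius K -> mdist (@center K i) y' <= radius K ->
    mdist (@center K i) y'' <= radius K -> mdist (@center K j) z <= radius K ->
    mdist (f y) (f y') <= mdist (f y'') (f z) }.

(** Discarding the part of the ball outside the residue does not make the image
of the ball thin, so the packing can be centred at images of points of the
residue. *)
Lemma residue_packing t p eta delta : separable P -> residue f t p ->
    0 < eta -> 0 < delta ->
  exists (I : finType) (q : I -> P) (r : I -> R),
    [/\ forall i, residue f t (q i), forall i, mdist p (q i) < eta,
        is_packing setT (f \o q) r, is_fine delta r & 1 <= \sum_i r i `^ t].
Proof.
move=> sepP pt eta0 delta0.
pose E := f @` ([set q | mdist p q < eta] `&` residue f t).
have nE : ~ thin t E.
  move=> Et; apply: (pt _ eta0).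
  pose F (n : nat) := if n is 0%N then E else f @` (~` residue f t).
  apply: (@sigma_thinS _ _ _ _ (\bigcup_n F n)).
    move=> _ [q /= pq <-]; have [qt|qt] := pselect (residue f t q).
      by exists 0%N => //; exists q.
    by exists 1%N => //; exists q.
  apply: sigma_thin_bigcup => -[|n] /=; last exact: sigma_thin_residueC.
  by exists (fun _ => E) => // x Ex; exists 0%N.
have [I [x [r [[xE r0 xr] rfine W]]]] : exists (I : finType) (x : I -> X) (r : I -> R),
    [/\ is_packing E x r, is_fine delta r & 1 <= \sum_i r i `^ t].
  apply: contrapT => H; apply: nE; exists delta => // I x r xr rfine.
  by rewrite leNgt; apply/negP => /ltW W; apply: H; exists I, x, r.
have /choice[q qP] : forall i, exists q, [/\ mdist p q < eta, residue f t q & f q = x i].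
  by move=> i; have [q [? ?] ?] := xE i; exists q.
exists I, q, r; split => //.
- by move=> i; have [] := qP i.
- by move=> i; have [] := qP i.
- have -> : f \o q = x by apply/funext => i; have [] := qP i.
  by split.
Qed.

Lemma continuous_dist (q : P) eps : {for q, continuous f} -> 0 < eps ->
  exists2 e, 0 < e & forall y, mdist q y <= e -> mdist (f q) (f y) <= eps.
Proof.
move=> /metricType_numDomainType.cvgrPdist_lt fq eps0.
have /nbhs_ballP[e /= e0 eP] := fq eps eps0.
exists (e / 2); first by rewrite divr_gt0.
move=> y qy; apply/ltW/eP; rewrite ballEmdist/=.
by apply: le_lt_trans qy _; rewrite gtr_pMr// invf_lt1// ltr1n.
Qed.

(** The flat packing is obtained by applying the Ramsey theorem to the packing
of residue_packing.  Being finite, it leaves a margin c in all strict inequalities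
between radii and distances, and continuity of f provides balls whose images
stay within c / 4 of the centers. *)
Lemma refine_ex t k p eta delta : separable P -> continuous f -> (0 < k)%N ->
    residue f t p -> 0 < eta -> 0 < delta ->
  exists K, refines (residue f t) (16 * k%:R) (t * (1 - k%:R^-1)) (p, eta) delta K.
Proof.
move=> sepP fcont k0 pt eta0 delta0.
have [I [q [r [qt pq [_ r0 qr] rfine W]]]] :=
  residue_packing sepP pt eta0 delta0.
pose d i j := mdist (f (q i)) (f (q j)).
have rd i j : i <> j -> r i < d i j.
  by move=> ij; rewrite ltNge; apply/negP; exact: qr.
have [S [SW Sf]] : exists S : {set I},
    1 <= \sum_(z in S) (r z `^ t) `^ (1 - k%:R^-1) /\
    flat d (16 * k%:R) [set` S].
  apply: ramsey => //.
  - by move=> i; rewrite /d mdistxx.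
  - by move=> i j; rewrite /d metric_sym.
  - by move=> *; exact: metric_triangle.
  - by move=> i j /eqP ij; exact: lt_trans (rd i j ij).
  - by move=> i; rewrite powR_gt0.
pose h (a : 'I_#|S|) := enum_val a.
have h_inj : injective h by exact: enum_val_inj.
have [c c0 cd] : exists2 c, 0 < c & forall ab : 'I_#|S| * 'I_#|S|,
    ab.1 <> ab.2 -> r (h ab.1) + c <= d (h ab.1) (h ab.2) /\
                    4 * c <= d (h ab.1) (h ab.2).
  apply: small_enough => [[a b]/= e e' e0 ee' H /H[]|[a b]/=]; first by split; lra.
  have [ab|ab] := pselect (a = b); first by exists 1.
  have hab : h a <> h b by move/h_inj.
  exists (Num.min (d (h a) (h b) - r (h a)) (d (h a) (h b) / 4)).
    by rewrite lt_min subr_gt0 rd//= divr_gt0// (lt_trans (r0 (h a)))// rd.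
  move=> _; split; first by rewrite -lerBrDl ge_min lexx.
  by rewrite mulrC -ler_pdivlMr// ge_min lexx orbT.
have [e e0 eP] : exists2 e, 0 < e & forall a : 'I_#|S|,
    [/\ e <= delta, forall y, mdist (q (h a)) y <= e -> mdist p y <= eta &
        forall y, mdist (q (h a)) y <= e -> mdist (f (q (h a))) (f y) <= c / 4].
  apply: small_enough => [a u v v0 vu [H1 H2 H3]|a].
    split; first exact: le_trans H1.
      by move=> y yv; apply: H2; exact: le_trans vu.
    by move=> y yv; apply: H3; exact: le_trans vu.
  have c4 : 0 < c / 4 by rewrite divr_gt0.
  have [u u0 uP] := continuous_dist (fcont (q (h a))) c4.
  exists (Num.min delta (Num.min (eta - mdist p (q (h a))) u)).
    by rewrite !lt_min delta0 u0 subr_gt0 pq.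
  split; first by rewrite ge_min lexx.
    move=> y; rewrite !le_min => /and3P[_ qy _].
    apply: le_trans (metric_triangle p (q (h a)) y) _.
    by rewrite -lerBrDl.
  by move=> y; rewrite !le_min => /and3P[_ _ qy]; exact: uP.
have near a y : mdist (q (h a)) y <= e -> mdist (f (q (h a))) (f y) <= c / 4.
  by have [_ _ ] := eP a; exact.
have far a b y z : a <> b -> mdist (q (h a)) y <= e -> mdist (q (h b)) z <= e ->
    d (h a) (h b) - c / 2 <= mdist (f y) (f z) <= d (h a) (h b) + c / 2.
  move=> ab /near fy /near fz; rewrite /d.
  have t1 := metric_triangle (f (q (h a))) (f y) (f (q (h b))).
  have t2 := metric_triangle (f y) (f z) (f (q (h b))).
  have t3 := metric_triangle (f y) (f (q (h a))) (f z).
  have t4 := metric_triangle (f (q (h a))) (f (q (h b))) (f z).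
  rewrite (metric_sym (f z) (f (q (h b)))) in t2.
  rewrite (metric_sym (f y) (f (q (h a)))) in t3.
  by apply/andP; split; lra.
have J : 'I_#|S|.
  have [/eqP S0|] := boolP (#|S| == 0)%N; last first.
    by rewrite -lt0n; case: #|S| => // n _; exact: ord0.
  by move: SW; rewrite big_enum_val big1 ?ler10// => a; have := ltn_ord a; rewrite {2}S0.
exists (@Children 'I_#|S| (q \o h) (r \o h) e); split => //=.
- by have [] := eP J.
- by move=> a; have [_ + _] := eP a; exact.
- apply: (le_trans SW); rewrite big_enum_val; apply: ler_sum => a _.
  by rewrite powRrM.
- apply: (@flat_comp _ _ _ d h) Sf => a /=; exact: enum_valP.
- move=> a b y z ab ya zb; have [/= c1 c2] := cd (a, b) ab.
  have /andP := far a b y z ab ya zb; rewrite /d in c1 c2 * => -[t1 t2].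
  by split; lra.
- move=> a b y y' y'' z ab ya ya' ya'' zb; have [/= c1 c2] := cd (a, b) ab.
  have /andP[t1 t2] := far a b y'' z ab ya'' zb.
  have t3 := metric_triangle (f y) (f (q (h a))) (f y').
  rewrite /d in c1 c2 t1 t2; rewrite (metric_sym (f y) (f (q (h a)))) in t3.
  move: (near _ _ ya) (near _ _ ya'); lra.
Qed.

End refinement.

(** * The attractor of a tree *)

Section tree.
Context {R : realType} {P X : metricType R}.
Variables (f : P -> X) (good : set P) (D s : R).
Variables (K : nat -> P * R -> @children R P) (root : P * R).
Hypotheses (root_good : good root.1) (root_gt0 : 0 < root.2)
  (K_refines : forall n N, good N.1 -> 0 < N.2 ->
     refines f good D s N n.+1%:R^-1 (K n N)).

Definition kid n N (i : child_index (K n N)) : P * R := (center i, radius (K n N)).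

Definition branch (N : nat -> P * R) : Prop :=
  N 0%N = root /\ forall n, exists i : child_index (K n (N n)), N n.+1 = kid i.

Definition through (N : nat -> P * R) (z : P) : Prop :=
  forall n, mdist (N n).1 z <= (N n).2.

Definition attractor : set X :=
  f @` [set z | exists2 N, branch N & through N z].

Lemma branch_good N n : branch N -> good (N n).1 /\ 0 < (N n).2.
Proof.
move=> [N0 NS]; elim: n => [|n [gn rn]]; first by rewrite N0.
have [i ->] := NS n; have := K_refines n gn rn => H /=.
by split; [exact: center_good H i | exact: radius_gt0 H].
Qed.

Lemma branch_refines N n : branch N ->
  refines f good D s (N n) n.+1%:R^-1 (K n (N n)).
Proof. by move=> /branch_good-/(_ n)[gn rn]; exact: K_refines. Qed.

Lemma branch_radius N n : branch N -> (N n.+1).2 <= n.+1%:R^-1.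
Proof.
move=> bN; have [i ->] := bN.2 n; exact: radius_le (branch_refines n bN).
Qed.

Lemma branch_sub N m n y : branch N -> (m <= n)%N ->
  mdist (N n).1 y <= (N n).2 -> mdist (N m).1 y <= (N m).2.
Proof.
move=> bN; elim: n => [|n IH]; first by rewrite leqn0 => /eqP->.
rewrite leq_eqVlt => /predU1P[->//|mn]; have [i ->] := bN.2 n => ny.
by apply: IH => //; exact: (child_sub (branch_refines n bN)) ny.
Qed.

Lemma through_inj N z z' : branch N -> through N z -> through N z' -> z = z'.
Proof.
move=> bN Nz Nz'; apply: contrapT => /eqP; rewrite -mdist_gt0 => zz'.
have [n] := ltr_add_invr (divr_gt0 zz' (ltr0n R 2)).
rewrite add0r ltNge => /negP; apply; rewrite ler_pdivrMr// mulr_natr mulr2n.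
have rn := branch_radius n bN.
apply: le_trans (metric_triangle z (N n.+1).1 z') _.
by rewrite lerD// ?(le_trans (Nz' _))// metric_sym (le_trans (Nz _)).
Qed.

Lemma branch_limit N : complete_space P -> branch N -> exists z, through N z.
Proof.
move=> Pcomplete bN; pose c n := (N n).1.
have cc m n : (m <= n)%N -> mdist (c m) (c n) <= (N m).2.
  move=> mn; apply: (branch_sub bN mn).
  by rewrite mdistxx ltW//; have [] := branch_good n bN.
have [|z cz] := Pcomplete (c @ \oo) _.
  apply: cauchy_exP => e e0; have [n] := ltr_add_invr e0.
  rewrite add0r => ne; exists (c n.+1); exists n.+1 => //= m /= nm.
  rewrite ballEmdist/=; apply: le_lt_trans (cc _ _ nm) _.
  exact: le_lt_trans (branch_radius n bN) ne.
exists z => m; apply/ler_addgt0Pr => e e0.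
move/metricType_numDomainType.cvgrPdist_lt : cz => /(_ e e0)[n _ nz].
have := nz (maxn m n) (leq_maxr _ _) => /=; rewrite metric_sym => cz.
apply: le_trans (metric_triangle _ (c (maxn m n)) _) _.
by rewrite lerD ?cc ?leq_maxl// ltW.
Qed.

Lemma branch_split N M l : branch N -> branch M -> N l <> M l ->
  exists n, [/\ (n < l)%N, forall m, (m <= n)%N -> N m = M m &
    exists i j : child_index (K n (N n)),
      [/\ i <> j, N n.+1 = kid i & M n.+1 = kid j]].
Proof.
move=> bN bM; elim/ltn_ind: l => -[_|l IH NM]; first by rewrite bN.1 bM.1.
have [[m ml Nm]|H] := pselect (exists2 m, (m <= l)%N & N m <> M m).
  have [n [nm ? ?]] := IH m ml Nm; exists n; split => //.
  by rewrite (ltn_trans nm).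
have {}H m : (m <= l)%N -> N m = M m.
  by move=> ml; apply: contrapT => Nm; apply: H; exists m.
exists l; split => //; have [i Ni] := bN.2 l; have := bM.2 l.
rewrite -(H l (leqnn l)) => -[j Mj]; exists i, j; split => // ij.
by apply: NM; rewrite Ni Mj ij.
Qed.

(** Let x and y have branches N and M that separate after the common node N n.
A chain from x to y with steps at most e stays in N n, unless e is at least the
distance from N n to a sibling of N n or of one of its ancestors, in which case
the distance between x and y is at most e.  If it stays, the children of N n that it visits have
centers forming a chain with steps at most 2e, so that flatness of the family of
centers bounds the distance between the centers of the children of x and y by
2De, hence the distance between x and y by 4De. *)
Lemma attractor_flat : 1 <= D ->
  flat (fun x y : X => mdist x y) (4 * D) attractor.
Proof.
move=> D1 e _ _ e0 [x [N bN Nx] <-] [y [M bM My] <-] xy.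
have [yx|] := lerP (mdist (f x) (f y)) e.
  apply: (le_trans yx); rewrite ler_peMl//; lra.
move=> exy.
have [NM|/existsNP[l NM]] := pselect (forall l, N l = M l).
  have -> : y = x.
    by apply: (through_inj bM) => // n; rewrite -NM.
  by rewrite mdistxx !mulr_ge0// (le_trans _ D1).
have [n [_ NMn [i [j [ij Ni Mj]]]]] := branch_split bN bM NM.
have refn := branch_refines n bN.
have xi : mdist (center i) x <= radius (K n (N n)) by have := Nx n.+1; rewrite Ni.
have yj : mdist (center j) y <= radius (K n (N n)) by have := My n.+1; rewrite Mj.
pose dK (i j : child_index (K n (N n))) := mdist (f (center i)) (f (center j)).
(* The part of the chain from x known to stay in the node N n and to shadow a
   chain of centers. *)
pose A : set X := [set a | exists2 z, f z = a & exists L, [/\ branch L, through L z,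
  forall m, (m <= n)%N -> L m = N m &
  exists2 i', L n.+1 = kid i' & linked dK setT (2 * e) i i']].
have : A (f y).
  apply: xy.
    exists x => //; exists N; split => //; exists i => //; exact: linked_refl.
  move=> _ _ [a <- [L [bL La LN [i' Li' ii']]]] [b [L' bL' Lb] <-] ab.
  have [LL'|] := pselect (forall m, (m <= n)%N -> L' m = N m); last first.
    move=> /existsNP[m /not_implyP[mn Lm]].
    (* The step from a to b would leave N p.+1, which is N n or one of its
       ancestors. *)
    have [p [pm _ [u [v [uv Lu Nv]]]]] := branch_split bL' bN Lm.
    have pn : (p.+1 <= n)%N by exact: leq_trans mn.
    have inv w W : W p.+1 = N p.+1 -> through W w ->
        mdist (center v) w <= radius (K p (L' p)).
      by move=> WN /(_ p.+1); rewrite WN Nv.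
    have bu : mdist (center u) b <= radius (K p (L' p)) by have := Lb p.+1; rewrite Lu.
    have := child_diam (branch_refines p bL') (nesym uv) (inv _ _ erefl Nx)
      (inv _ _ (esym (NMn _ pn)) My) (inv _ _ (LN _ pn) La) bu.
    by move=> /le_trans/(_ ab); rewrite leNgt exy.
  exists b => //; exists L'; split => //.
  have := bL'.2 n; rewrite LL'// => -[j' Lj']; exists j' => //.
  have [->//|ij'] := pselect (j' = i').
  apply: (linked_trans ii'); apply: linked_step => //.
  have ai : mdist (center i') a <= radius (K n (N n)) by have := La n.+1; rewrite Li'.
  have bj : mdist (center j') b <= radius (K n (N n)) by have := Lb n.+1; rewrite Lj'.
  have [_ + _] := child_sep refn (nesym ij') ai bj.
  by move=> /le_trans; apply; rewrite ler_pM2l.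
move=> [y' fy [L [bL Ly LN [i' Li' ii']]]].
have yi : mdist (center i') y' <= radius (K n (N n)) by have := Ly n.+1; rewrite Li'.
have i'j : i' = j.
  apply: contrapT => i'j; have [] := child_sep refn i'j yi yj.
  by rewrite fy mdistxx ltNge (ltW (size_of_gt0 refn _)).
rewrite i'j in ii'; have [_ _ /le_trans->//] := child_sep refn ij xi yj.
have e2 : 0 <= 2 * e by rewrite mulr_ge0.
have := center_flat refn e2 I I ii'; rewrite -/(dK _ _); lra.
Qed.

(** Otherwise every F n has a fineness delta n at which its packings have sums
less than 1.  At a node so deep that the packing of its children is finer than
delta n, some child then avoids F n; a branch that passes through such a child
for every n has a limit outside all F n. *)
Lemma attractor_packing_pre (F : nat -> set X) u :
  complete_space P -> 0 <= u -> u <= s -> attractor `<=` \bigcup_n F n ->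
  exists n, (1 <= packing_pre u (F n))%E.
Proof.
move=> Pcomplete u0 us SF; apply: contrapT => H.
have /choice[delta deltaP] n : exists delta, 0 < delta /\
    (packing_delta u delta (F n) < 1)%E.
  have : (packing_pre u (F n) < 1)%E.
    by rewrite ltNge; apply/negP => nF; apply: H; exists n.
  by move=> /ereal_inf_lt[_ [d /= d0 <-] d1]; exists d.
(* The child chosen at depth m is to avoid the set of index logn 2 m: every
   index is treated at arbitrarily large depths. *)
have /choice[nxt nxtP] (nN : nat * (P * R)) : exists N' : P * R,
    good nN.2.1 -> 0 < nN.2.2 ->
    (exists i : child_index (K nN.1 nN.2), N' = kid i) /\
    (nN.1.+1%:R^-1 <= delta (logn 2 nN.1) ->
     forall z, mdist N'.1 z <= N'.2 -> ~ F (logn 2 nN.1) (f z)).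
  case: nN => n N /=; have [[gN N0]|nN] := pselect (good N.1 /\ 0 < N.2); last first.
    by exists root => gN N0; case: nN.
  have ref := K_refines n gN N0; set m := logn 2 n.
  suff [i iP] : exists i : child_index (K n N), n.+1%:R^-1 <= delta m ->
      forall z, mdist (@center _ _ (K n N) i) z <= radius (K n N) -> ~ F m (f z).
    by exists (kid i) => _ _; split; [exists i|].
  apply: contrapT => /forallNP nP.
  (* If F m met every child, points of F m in the children would carry a
     packing of mass at least 1. *)
  have {}nP i : n.+1%:R^-1 <= delta m /\
      exists2 z, mdist (@center _ _ (K n N) i) z <= radius (K n N) & F m (f z).
    have /not_implyP[nd /existsNP[z /not_implyP[iz /contrapT Fz]]] := nP i.
    by split => //; exists z.
  have /choice[z zP] (i : child_index (K n N)) : exists z,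
      mdist (center i) z <= radius (K n N) /\ F m (f z).
    by have [_ [z ? ?]] := nP i; exists z.
  have nd (i : child_index (K n N)) : n.+1%:R^-1 <= delta m by have [] := nP i.
  have := (deltaP m).2; apply/negP; rewrite -leNgt.
  apply: (@le_trans _ _ ((\sum_(i : child_index (K n N)) size_of i `^ u)%:E)).
    rewrite lee_fin; apply: le_trans (size_of_sum ref) _.
    apply: ler_sum => i _; apply: ger_powR us.
    rewrite (size_of_gt0 ref) (le_trans (size_of_le ref i))//.
    by rewrite invf_le1// ler1n.
  apply: (@packing_delta_ge _ _ _ _ _ _ (fun i => f (z i))).
    split; [by move=> i; case: (zP i)|exact: size_of_gt0 ref|].
    move=> i j ij; rewrite /cball/= => /le_lt_trans H'.
    have [/H' + _ _] := child_sep ref ij (zP i).1 (zP j).1.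
    by rewrite ltxx.
  by move=> i; apply: le_trans (size_of_le ref i) (nd i).
pose N := fix N n := if n is m.+1 then nxt (m, N m) else root.
have Ngood n : good (N n).1 /\ 0 < (N n).2.
  elim: n => [//|n [gn rn]] /=; have [[i ->] _] := nxtP (n, N n) gn rn.
  have ref := K_refines n gn rn.
  by split; [exact: center_good ref i | exact: radius_gt0 ref].
have bN : branch N.
  by split => // n; have [gn rn] := Ngood n; have [] := nxtP (n, N n) gn rn.
have [z Nz] := branch_limit Pcomplete bN.
have [|n _ Fn] := SF (f z); first by exists z => //; exists N.
have [j jd] : exists j : nat, j.+1%:R^-1 < delta n.
  by have [j] := ltr_add_invr (deltaP n).1; rewrite add0r; exists j.
pose m := (2 ^ n * 3 ^ j)%N.
have mn : logn 2 m = n.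
  by rewrite lognM ?expn_gt0// pfactorK// lognX (_ : logn 2 3 = 0)%N// muln0 addn0.
have jm : (j <= m)%N.
  rewrite (leq_trans (ltnW (ltn_expl j (isT : 1 < 3)%N)))// leq_pmull//.
  by rewrite expn_gt0.
have [gm rm] := Ngood m; have [_] := nxtP (m, N m) gm rm; rewrite /= mn => avoid.
apply: (avoid _ z (Nz m.+1)) => //; apply: le_trans (ltW jd).
by rewrite lef_pV2 ?posrE// ler_nat.
Qed.

Lemma attractor_packing_dim : complete_space P ->
  (s%:E <= packing_dim attractor)%E.
Proof.
move=> Pcomplete; apply: le_ereal_inf_tmp => _ [u [u0 uS] <-].
rewrite lee_fin leNgt; apply/negP => us.
suff : (1 <= packing_measure u attractor)%E by rewrite uS lee_fin ler10.
apply: le_ereal_inf_tmp => _ [F SF <-].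
have [n Fn] := attractor_packing_pre Pcomplete (ltW u0) (ltW us) SF.
have pre0 m : (0 <= packing_pre u (F m))%E := packing_pre_ge0 u (F m).
apply: (le_trans Fn); apply: le_trans (nneseries_lim_ge n.+1 _) => //.
by rewrite big_nat_recr//= leeDr// sume_ge0.
Qed.

End tree.

(** * The chain ultrametric of a flat set *)

(** The set S with the distance of chain_dist; the hypotheses are arguments so
that the metric structure can be inferred from the type. *)
Definition chain_space {R : realType} {X : metricType R} (S : set X) (D : R)
  (D0 : 0 < D) (Sflat : flat (fun x y : X => mdist x y) D S) : Type := S.

Section chain_metric.
Context {R : realType} {X : metricType R}.
Variables (S : set X) (D : R).
Hypotheses (D0 : 0 < D) (Sflat : flat (fun x y : X => mdist x y) D S).

Let lk e (x y : S) : Prop :=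
  linked (fun x y : X => mdist x y) S e (set_val x) (set_val y).

Let Sval (x : S) : S (set_val x).
Proof. exact: set_valP. Qed.

Definition chain_dist (x y : S) : R := inf [set e | 0 <= e /\ lk e x y].

Let chain_set_inf x y : has_inf [set e | 0 <= e /\ lk e x y].
Proof.
split; last by exists 0 => e [].
by exists (mdist x y); split; [exact: mdist_ge0|exact: linked_step].
Qed.

Let chain_dist_le e x y : 0 <= e -> lk e x y -> chain_dist x y <= e.
Proof. by move=> e0 xy; apply: ge_inf => //; case: (chain_set_inf x y). Qed.

Let chain_dist_lt e x y : chain_dist x y < e -> lk e x y.
Proof.
move=> /(inf_lt (chain_set_inf x y).1)[e' [_ xy] /ltW ee'].
exact: linked_le xy.
Qed.

Let chain_dist_ge0 x y : 0 <= chain_dist x y.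
Proof. by apply: lb_le_inf => [|e []]//; case: (chain_set_inf x y). Qed.

Lemma chain_dist_le_mdist x y : chain_dist x y <= mdist x y.
Proof. by apply: chain_dist_le; [exact: mdist_ge0|exact: linked_step]. Qed.

Lemma mdist_le_chain_dist x y : mdist x y <= D * chain_dist x y.
Proof.
rewrite mulrC -ler_pdivrMr//; apply/ler_addgt0Pr => e e0.
rewrite ler_pdivrMr// mulrC; apply: Sflat => //.
  by rewrite addr_ge0// ltW.
by apply: chain_dist_lt; rewrite ltrDl.
Qed.

Let chain_distxx x : chain_dist x x = 0.
Proof.
by apply/eqP; rewrite eq_le chain_dist_ge0 andbT; exact: chain_dist_le.
Qed.

Let chain_dist_eq0 x y : chain_dist x y = 0 -> x = y.
Proof.
move=> xy; apply: mdist_positivity; apply/eqP; rewrite eq_le mdist_ge0 andbT.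
by rewrite (le_trans (mdist_le_chain_dist x y))// xy mulr0.
Qed.

Let lk_sym e x y : lk e x y -> lk e y x.
Proof.
move=> xy; apply: (xy (fun z => S z /\ linked (fun x y => mdist x y) S e z _) _ _).2.
  by split => //; exact: linked_refl.
move=> a b [Sa ax] Sb ab; split => //; apply: linked_trans ax.
by apply: linked_step => //; rewrite metric_sym.
Qed.

Let chain_dist_sym x y : chain_dist x y = chain_dist y x.
Proof.
by rewrite /chain_dist; congr inf; apply/seteqP; split => e [e0 /lk_sym].
Qed.

Lemma chain_dist_ultra x y z :
  chain_dist x z <= Num.max (chain_dist x y) (chain_dist y z).
Proof.
apply/ler_addgt0Pr => e e0; apply: chain_dist_le.
  by rewrite addr_ge0 ?(ltW e0)// le_max chain_dist_ge0.
apply: (@linked_trans _ _ _ _ _ (set_val y)); apply: chain_dist_lt.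
  by rewrite (@le_lt_trans _ _ (Num.max (chain_dist x y) (chain_dist y z))) ?ltrDl// le_max lexx.
by rewrite (@le_lt_trans _ _ (Num.max (chain_dist x y) (chain_dist y z))) ?ltrDl// le_max lexx orbT.
Qed.

Let chain_dist_triangle y x z :
  chain_dist x z <= chain_dist x y + chain_dist y z.
Proof.
apply: le_trans (chain_dist_ultra x y z) _.
by rewrite ge_max lerDl lerDr !chain_dist_ge0.
Qed.

Local Notation U := (chain_space D0 Sflat).

HB.instance Definition _ := Choice.on U.
HB.instance Definition _ := @isMetric.Build R U chain_dist
  chain_distxx chain_dist_eq0 chain_dist_sym chain_dist_triangle.

Lemma chain_space_ultrametric : ultrametric U.
Proof. exact: chain_dist_ultra. Qed.

Lemma chain_space_equivalent : lipschitz_equivalent (set_type S) U.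
Proof.
exists (fun x => x), (fun x => x); split => //.
  by exists 1 => x y; rewrite mul1r; exact: chain_dist_le_mdist.
by exists D => x y; exact: mdist_le_chain_dist.
Qed.

(** Subspaces of a separable metric space are separable, and the chain distance
is smaller than the original one. *)
Lemma chain_space_separable : separable X -> separable U.
Proof.
move=> sepX; have [[x0 _]|nS] := pselect (exists x : S, True); last first.
  exists set0; split; first exact: countable0.
  by move=> O [x _]; case: nS; exists x.
have [e eP] := separable_enum sepX (set_val x0).
have /choice[g gP] (k : nat * nat) : exists y : S,
    forall x : S, mdist (e k.1) (set_val x) < k.2.+1%:R^-1 ->
      mdist (e k.1) (set_val y) < k.2.+1%:R^-1.
  have [[y ky]|nk] := pselect (exists y : S, mdist (e k.1) (set_val y) < k.2.+1%:R^-1).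
    by exists y.
  by exists x0 => x kx; case: nk; exists x.
exists (range g : set U); split.
  by apply: card_le_trans (card_image_le _ _) _; exact: countableP.
move=> O [x Ox]; rewrite openE => /(_ x Ox)/nbhs_ballP[r /= r0 xr].
have r2 : 0 < r / 2 by rewrite divr_gt0.
have [m] := ltr_add_invr r2; rewrite add0r => mr.
have m0 : 0 < m.+1%:R^-1 :> R by rewrite invr_gt0.
have [n xn] := eP (set_val x) _ m0.
exists (g (n, m)); split; last by exists (n, m).
apply: xr; rewrite ballEmdist/=.
apply: le_lt_trans (chain_dist_le_mdist x (g (n, m))) _.
apply: le_lt_trans (metric_triangle _ (e n) _) _.
rewrite [ltRHS]splitr ltrD// ?(lt_trans xn)//; apply: lt_trans mr.
by apply: (gP (n, m) x); rewrite /= metric_sym.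
Qed.

End chain_metric.

Lemma flat_ultrametric (R : realType) (X : metricType R) (S : set X) (D : R) :
  separable X -> 0 < D -> flat (fun x y : X => mdist x y) D S ->
  exists U : metricType R,
    [/\ separable U, ultrametric U & lipschitz_equivalent (set_type S) U].
Proof.
move=> sepX D0 Sflat; exists (chain_space D0 Sflat); split.
- exact: chain_space_separable.
- exact: chain_space_ultrametric.
- exact: chain_space_equivalent.
Qed.

(** * Ultrametric subsets of large packing dimension *)

Unset Implicit Arguments.

Theorem mainTheorem1 (R : realType) (X : metricType R) (s : R)
    (Xsep : separable X) (Xan : analytic X)
    (dimX : (s%:E < packing_dim [set: X])%E) :
  exists S : set X, (s%:E < packing_dim S)%E /\
    exists U : metricType R,
      [/\ separable U, ultrametric U & lipschitz_equivalent (set_type S) U].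
Proof.
(* Packing dimensions are nonnegative, and X may contain no point to start
   from. *)
have [s0|s0] := ltP s 0.
  exists set0; split.
    by apply: lt_le_trans (packing_dim_ge0 _); rewrite lte_fin.
  by apply: (@flat_ultrametric _ _ _ 1) => // e x y _ [].
have [P [f [Pcomplete Psep fcont fsurj]]] := Xan.
have [u su uX] : exists2 u, s < u & (u%:E < packing_dim [set: X])%E.
  case: (packing_dim [set: X]) dimX => [v|_|//].
    rewrite lte_fin => sv; exists ((s + v) / 2); last rewrite lte_fin; lra.
  by exists (s + 1); [rewrite ltrDl|rewrite ltry].
pose t := (s + u) / 2.
have [st tu] : s < t /\ t < u by rewrite /t; split; lra.
have t0 : 0 < t by exact: le_lt_trans st.
have [p0 pt] : exists p, residue f t p.
  apply: contrapT => /forallNP np.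
  suff : (packing_dim [set: X] <= u%:E)%E by rewrite leNgt uX.
  apply: (sigma_thin_packing_dim _ tu); first exact: lt_trans tu.
  apply: sigma_thinS (sigma_thin_residueC f t Psep) => x _.
  have : [set: X] x by []; rewrite -fsurj => -[p _ <-].
  by exists p => //; exact: np.
have [k tk] : exists k : nat, k.+1%:R^-1 < (t - s) / t.
  have ts : 0 < (t - s) / t by rewrite divr_gt0// subr_gt0.
  by have [k] := ltr_add_invr ts; rewrite add0r; exists k.
pose s' := t * (1 - k.+1%:R^-1).
have ss' : s < s'.
  by move: tk; rewrite ltr_pdivlMr// /s' mulrBr mulr1 (mulrC t) ltrBrDr addrC -ltrBrDr.
have /choice[K KP] (nN : nat * (P * R)) : exists K, residue f t nN.2.1 -> 0 < nN.2.2 ->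
    refines f (residue f t) (16 * k.+1%:R) s' nN.2 nN.1.+1%:R^-1 K.
  case: nN => n [p eta]/=.
  have [[pr eta0]|np] := pselect (residue f t p /\ 0 < eta); last first.
    exists (@Children _ _ void (fun i : void => match i with end)
      (fun i : void => match i with end) 0) => pr eta0.
    by case: np.
  have n0 : 0 < n.+1%:R^-1 :> R by rewrite invr_gt0.
  by have [K ?] := refine_ex Psep fcont (ltn0Sn k) pr eta0 n0; exists K.
pose S := attractor f (fun n N => K (n, N)) (p0, 1).
have KR n N := KP (n, N).
exists S; split.
  apply: (@lt_le_trans _ _ s'%:E); first by rewrite lte_fin.
  exact: (@attractor_packing_dim _ _ _ f (residue f t) (16 * k.+1%:R) s').
apply: (@flat_ultrametric _ _ _ (4 * (16 * k.+1%:R))) => //.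
apply: (@attractor_flat _ _ _ f (residue f t) _ s') => //.
have : 1 <= k.+1%:R :> R by rewrite ler1n.
lra.
Qed.
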